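(* Let $\boldsymbol\theta=(\theta_i)_{i\ge1}$ be a sequence of strictly positive reals with $\theta_1=1$, and let $\mathbf{p}=(p_i)_{i\ge1}$ be given by $p_1=0$, $p_2=1$ and $p_i=\frac{i-1}{i-1+\theta_i}$ for $i\ge3$. For any $n\ge2$, $$\mathcal{L}(X_1^{n,\mathbf{p}},X_2^{n,\mathbf{p}},\dots)=\chi_n*\mathcal{L}(Y^{\boldsymbol\theta}),$$ where $X_j^{n,\mathbf{p}}$ is set equal to $0$ for $j\ge n$, and the right-hand side is the push-forward of the law of $Y^{\boldsymbol\theta}$ under $\chi_n$. If moreover $\sum_{j=1}^\infty p_j=\infty$, then $$\mathcal{L}(X^{\infty,\mathbf{p}})=\chi_\infty*\mathcal{L}(Y^{\boldsymbol\theta}).$$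
   Context: Random derangement process: put $q_i=1-p_i$. For $n\ge 2$, $X^{n,\mathbf{p}}=(X^n_{n+1}=1,X^n_n,\dots,X^n_1)$ is the $\{0,1\}$-valued inhomogeneous Markov chain, run in decreasing index and started from $X^n_{n+1}=1$, such that $X^n_n=0$ a.s., $X^n_1=1$ a.s., and for $2\le r\le n-1$: $\mathbb{P}(X^n_r=0\mid X^n_{r+1}=0)=p_r$, $\mathbb{P}(X^n_r=1\mid X^n_{r+1}=0)=q_r$, $\mathbb{P}(X^n_r=0\mid X^n_{r+1}=1)=1$. (In the claim only the components $X^n_1,\dots,X^n_{n-1}$ are kept and all later ones are set to $0$.) When $\sum_jp_j=\infty$ the limits $\varphi_i=\lim_{n\to\infty}\mathbb{P}(X^n_i=1)$ exist, with $\varphi_1=1$, $\varphi_2=0$, $\varphi_i\in(0,1)$ for $i\ge3$, and $X^{\infty,\mathbf{p}}=(X_i^\infty)_{i\ge1}$ is the $\{0,1\}$-valued Markov chain, run in increasing index, with $X_1^\infty=1$, $\mathbb{P}(X^\infty_{i+1}=1\mid X^\infty_i=0)=\frac{\varphi_{i+1}}{1-\varphi_i}$ and $\mathbb{P}(X^\infty_{i+1}=1\mid X^\infty_i=1)=0$. Generalized Feller coupling: $Y^{\boldsymbol\theta}=(Y_i)_{i\ge1}$ is a sequence of independent $\{0,1\}$-valued random variables with $\mathbb{P}_{\boldsymbol\theta}(Y_i=0)=\frac{i-1}{i-1+\theta_i}$ (so $Y_1=1$ a.s.). Erasing maps: for $\mathbf{y}=(y_1,y_2,\dots)\in\{1\}\times\{0,1\}^{\mathbb{N}}$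 let $$\beta_i^n(\mathbf{y})=\mathbf{1}\{y_i=1\}\cdot\max\{0\le j\le n-i-1:\prod_{k=0}^jy_{i+k}=1\},\qquad\beta_i^\infty(\mathbf{y})=\mathbf{1}\{y_i=1\}\cdot\sup\{j\ge0:\prod_{k=0}^jy_{i+k}=1\},$$ with the value $0$ when $y_i=0$ (these count the consecutive $1$s right after $y_i=1$ in $(y_{i+1},\dots,y_{n-1})$ and in $(y_{i+1},y_{i+2},\dots)$, respectively). Put $\Phi_1^n=\Phi_1^\infty=1$, $\Phi_2^n=\Phi_2^\infty=0$, $\Phi_j^n=0$ for $j\ge n$, $\Phi_i^n(\mathbf{y})=\mathbf{1}\{y_i=1,\ \beta_i^n(\mathbf{y})\text{ even}\}$ for $3\le i\le n-1$, and $\Phi_i^\infty(\mathbf{y})=\mathbf{1}\{y_i=1,\ \beta_i^\infty(\mathbf{y})\text{ finite and even}\}$ for $i\ge3$. Then $\chi_n(\mathbf{y})=(\Phi_i^n(\mathbf{y}))_{i\ge1}$ and $\chi_\infty(\mathbf{y})=(\Phi_i^\infty(\mathbf{y}))_{i\ge1}$. *)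

(* Defs.v *)
From HB Require Import structures.
From mathcomp Require Import all_boot all_order all_algebra.
From mathcomp Require Import all_classical all_reals all_analysis.
Import Order.TTheory GRing.Theory Num.Theory.
Import numFieldNormedType.Exports.

Set Implicit Arguments.
Unset Strict Implicit.
Unset Printing Implicit Defensive.

Local Open Scope classical_set_scope.
Local Open Scope ring_scope.

(* A sequence (y_1, y_2, ...) indexed from 1 is stored as [y : nat -> bool] with
  y_i at position i - 1, so that no dummy coordinate enters the laws below.
  The space carries the product sigma-algebra. *)

Definition coordinate_events : set (set (nat -> bool)) :=
  \bigcup_k preimage_set_system setT (fun y : nat -> bool => y k) measurable.

Notation binseq := (g_sigma_algebraType coordinate_events).

Definition crd (y : nat -> bool) (i : nat) : bool := y i.-1.

Section ErasingMaps.
Implicit Types (y : nat -> bool) (n i j : nat).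

Definition all_ones y i j : bool :=
  (\prod_(0 <= k < j.+1) (crd y (i + k) : nat) == 1)%N.

(* For 1 <= i < n, the indices 0 <= j <= n - i - 1 are the j < n - i. *)
Definition beta n y i : nat :=
  (crd y i * \max_(j < n - i | all_ones y i j) j)%N.

(* An extended real, as the run of ones may be infinite; without the test on
   y_i the supremum would be over the empty set. *)
Definition betaInf (R : realType) y i : \bar R :=
  if crd y i then ereal_sup [set j%:R%:E | j in [set j | all_ones y i j]]
  else 0%E.

Definition Phi n y i : bool :=
  if i == 1%N then true else if i == 2%N then false
  else [&& (i < n)%N, crd y i & ~~ odd (beta n y i)].

Definition PhiInf (R : realType) y i : bool :=
  if i == 1%N then true else if i == 2%N then false
  else crd y i && `[< exists2 m : nat, betaInf R y i = m%:R%:E & ~~ odd m >].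

Definition chi n (y : binseq) : binseq := fun k => Phi n y k.+1.

Definition chiInf (R : realType) (y : binseq) : binseq :=
  fun k => PhiInf R y k.+1.

End ErasingMaps.

(* A process (X_i)_(i >= 1) is given as a function on [nat] whose value at 0 is
  never used. *)

Definition trajectory d (T : measurableType d) (X : nat -> {mfun T >-> bool})
  (w : T) : binseq := fun k => X k.+1 w.

Definition truncate d (T : measurableType d) (n : nat)
    (X : nat -> {mfun T >-> bool}) (j : nat) : {mfun T >-> bool} :=
  if (j < n)%N then X j else cst false.

Section Measurability.

Lemma measurable_crd (i : nat) :
  measurable_fun [set: binseq] (fun y : binseq => crd y i).
Proof.
move=> _ B mB; apply: sub_sigma_algebra; exists i.-1 => //.
by exists B.
Qed.

Lemma measurable_into_binseq d (T : measurableType d) (f : T -> binseq) :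
  (forall k, measurable_fun setT (fun w => f w k)) -> measurable_fun setT f.
Proof.
move=> mf.
have h : preimage_set_system setT f coordinate_events `<=` @measurable _ T.
  move=> _ [_ [k _ [B mB <-]] <-].
  have := mf k measurableT B mB.
  by rewrite !setTI.
exact: (@measurability _ _ T binseq setT f coordinate_events erefl h).
Qed.

Lemma measurable_finite_dep (g : (nat -> bool) -> bool) (N : nat) :
    (forall y z : nat -> bool, (forall k, (k < N)%N -> y k = z k) -> g y = g z) ->
  measurable_fun [set: binseq] (g : binseq -> bool).
Proof.
move=> gN; apply: (measurable_fun_bool true); rewrite setTI.
pose ext (t : {ffun 'I_N -> bool}) (k : nat) : bool :=
  if insub k is Some i then t i else false.
have -> : (g : binseq -> bool) @^-1` [set true] =
    \bigcup_(t in [set t | g (ext t)])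
      \bigcap_(i in [set: 'I_N]) [set y : binseq | y i = t i].
  apply/seteqP; split => [y /= gy|y [t /= gt yt]].
    exists [ffun i : 'I_N => y i] => /=.
      rewrite (gN _ y) // => k kN.
      by rewrite /ext insubT ffunE.
    by move=> i _ /=; rewrite ffunE.
  rewrite (gN _ (ext t)) // => k kN.
  by rewrite /ext insubT; exact: (yt (Ordinal kN)).
apply: fin_bigcup_measurable => // t _.
apply: fin_bigcap_measurable => // i _.
by have := @measurable_crd i.+1 measurableT [set t i] Logic.I; rewrite setTI.
Qed.

Lemma all_onesP y i j :
  reflect (forall k, (k <= j)%N -> crd y (i + k)) (all_ones y i j).
Proof.
apply: (iffP eqP) => [H k kj|H].
  move: H; rewrite big_mkord (bigD1 (Ordinal (kj : k < j.+1)%N)) //= => /eqP.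
  by rewrite muln_eq1 eqb1 => /andP[].
by rewrite big_mkord big1 // => k _; rewrite H // -ltnS.
Qed.

Lemma eq_all_ones y z i j : (forall k, (k < i + j.+1)%N -> y k = z k) ->
  all_ones y i j = all_ones z i j.
Proof.
move=> yz; apply/all_onesP/all_onesP => H k kj; move: (H k kj);
  by rewrite /crd yz //; apply: (leq_ltn_trans (leq_pred _)); rewrite ltn_add2l ltnS.
Qed.

Lemma betaInfP (R : realType) y i m : betaInf R y i = m%:R%:E <->
  (if crd y i then all_ones y i m && ~~ all_ones y i m.+1 else m == 0)%N.
Proof.
rewrite /betaInf; case: ifP => yi; last first.
  split => [[]|/eqP -> //].
  by move/esym/eqP; rewrite pnatr_eq0.
set S := [set _ | _ in _].
have Sle j : all_ones y i j -> (j%:R%:E <= ereal_sup S :> \bar R)%E.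
  by move=> yj; apply: ereal_sup_ubound; exists j.
have mono j k : (k <= j)%N -> all_ones y i j -> all_ones y i k.
  move=> kj /all_onesP H; apply/all_onesP => l lk; apply: H.
  exact: leq_trans kj.
split => [Sm|/andP[ym ySm]]; last first.
  apply/eqP; rewrite eq_le Sle // andbT; apply: ge_ereal_sup => _ [j yj <-].
  rewrite lee_fin ler_nat leqNgt; apply: contra ySm => mj.
  exact: mono yj.
have ySm : ~~ all_ones y i m.+1.
  by apply/negP => /Sle; rewrite Sm lee_fin ler_nat ltnn.
rewrite ySm andbT; case: m => [|m] in Sm ySm *.
  by apply/all_onesP => k; rewrite leqn0 => /eqP ->; rewrite addn0.
apply: contraT => ym; suff : (ereal_sup S <= m%:R%:E)%E.
  by rewrite Sm lee_fin ler_nat ltnn.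
apply: ge_ereal_sup => _ [j yj <-]; rewrite lee_fin ler_nat leqNgt.
by apply: contra ym => mj; exact: mono yj.
Qed.

Lemma measurable_chi n : measurable_fun [set: binseq] (chi n).
Proof.
apply: measurable_into_binseq => k.
apply: (@measurable_finite_dep (fun y => Phi n y k.+1) (k.+1 + n).+1) => y z yz.
have yzc j : (j <= k.+1 + n)%N -> crd y j = crd z j.
  by move=> jn; apply: yz; rewrite ltnS; exact: leq_trans (leq_pred _) jn.
rewrite /Phi /beta (yzc k.+1 (leq_addr _ _)); case: ifP => // _; case: ifP => // _.
do 2 congr (_ && _); congr (~~ odd (_ * _)); apply: eq_bigl => j.
apply: eq_all_ones => l lj; apply: yz; rewrite ltnS ltnW //.
apply: (leq_trans lj); rewrite leq_add2l.
exact: leq_trans (ltn_ord j) (leq_subr _ _).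
Qed.

Lemma measurable_chiInf (R : realType) :
  measurable_fun [set: binseq] (chiInf R).
Proof.
apply: measurable_into_binseq => -[|[|j]]; rewrite /chiInf /PhiInf /=.
- exact: measurable_cst.
- exact: measurable_cst.
move: j.+2 => k; apply: measurable_and; first exact: measurable_crd.
apply: (measurable_fun_bool true); rewrite setTI.
pose b m (y : nat -> bool) := (if crd y k.+1
  then all_ones y k.+1 m && ~~ all_ones y k.+1 m.+1 else m == 0)%N.
rewrite (_ : _ @^-1` _ = \bigcup_(m in [set m | ~~ odd m])
    (b m : binseq -> bool) @^-1` [set true]); last first.
  apply/seteqP; split => [y /= /asboolP[m /betaInfP ym om]|y [m om /= ym]].
    by exists m.
  by apply/asboolP; exists m => //; apply/betaInfP.
apply: bigcup_measurable => m _; rewrite -[X in measurable X]setTI.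
apply: (@measurable_finite_dep (b m) (k.+1 + m.+2)) => // y z yz.
rewrite /b /crd yz; last by rewrite /= addnS ltnS ltnW // leq_addr.
case: ifP => // _; congr (_ && ~~ _); apply: eq_all_ones => l lk; apply: yz => //.
by rewrite (ltn_trans lk) // ltn_add2l.
Qed.

HB.instance Definition _ n :=
  isMeasurableFun.Build _ _ binseq binseq (chi n) (measurable_chi n).

HB.instance Definition _ (R : realType) :=
  isMeasurableFun.Build _ _ binseq binseq (chiInf R) (measurable_chiInf R).

Lemma measurable_trajectory d (T : measurableType d)
  (X : nat -> {mfun T >-> bool}) : measurable_fun setT (trajectory X).
Proof. by apply: measurable_into_binseq => k; exact: measurable_funPT. Qed.

HB.instance Definition _ d (T : measurableType d)
    (X : nat -> {mfun T >-> bool}) :=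
  isMeasurableFun.Build _ _ T binseq (trajectory X) (measurable_trajectory X).

End Measurability.

Section Processes.
Context {R : realType}.

Definition pr d (T : measurableType d) (P : probability T R) (A : set T) : R :=
  fine (P A).

(* Only meaningful when [pr P B != 0]. *)
Definition cpr d (T : measurableType d) (P : probability T R) (A B : set T) : R :=
  pr P (A `&` B) / pr P B.

Definition event d (T : measurableType d) (X : nat -> {mfun T >-> bool})
  (i : nat) (b : bool) : set T := [set w | X i w = b].

Definition history d (T : measurableType d) (X : nat -> {mfun T >-> bool})
  (I : set nat) (x : nat -> bool) : set T := \bigcap_(k in I) event X k (x k).

(* Given the values of X on [I], the variable X_t depends only on X_s; here [I]
   is the set of times up to and including s, the time visited just before t. *)
Definition markov_step d (T : measurableType d) (P : probability T R)
    (X : nat -> {mfun T >-> bool}) (I : set nat) (s t : nat) : Prop :=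
  forall (x : nat -> bool) (b : bool), pr P (history X I x) != 0 ->
    cpr P (event X t b) (history X I x) = cpr P (event X t b) (event X s (x s)).

(* Transition probabilities are prescribed only from states of positive
   probability. *)
Definition transition d (T : measurableType d) (P : probability T R)
    (X : nat -> {mfun T >-> bool}) (s t : nat) (a b : bool) (q : R) : Prop :=
  pr P (event X s a) != 0 -> cpr P (event X t b) (event X s a) = q.

(* The chain runs through the times n + 1, n, ..., 1. *)
Record derangement_process (p : nat -> R) (n : nat) d (T : measurableType d)
    (P : probability T R) (X : nat -> {mfun T >-> bool}) : Prop := {
  dp_start : pr P (event X n.+1 true) = 1;
  dp_n : pr P (event X n false) = 1;
  dp_1 : pr P (event X 1%N true) = 1;
  dp_markov : forall r, (1 <= r <= n)%N ->
    markov_step P X [set k | (r < k <= n.+1)%N] r.+1 r;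
  dp_00 : forall r, (2 <= r <= n.-1)%N ->
    transition P X r.+1 r false false (p r);
  dp_01 : forall r, (2 <= r <= n.-1)%N ->
    transition P X r.+1 r false true (1 - p r);
  dp_10 : forall r, (2 <= r <= n.-1)%N ->
    transition P X r.+1 r true false 1
}.

(* phi_i as the limit of P(X^n_i = 1); each X^n may live on its own space. *)
Definition limit_density (d : nat -> measure_display)
    (T : forall n, measurableType (d n)) (P : forall n, probability (T n) R)
    (X : forall n, nat -> {mfun T n >-> bool}) (i : nat) : R :=
  lim (pr (P n) (event (X n) i true) @[n --> \oo]).

Record limit_process (phi : nat -> R) d (T : measurableType d)
    (P : probability T R) (X : nat -> {mfun T >-> bool}) : Prop := {
  lp_start : pr P (event X 1%N true) = 1;
  lp_markov : forall i, (1 <= i)%N ->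
    markov_step P X [set k | (1 <= k <= i)%N] i i.+1;
  lp_01 : forall i, (1 <= i)%N ->
    transition P X i i.+1 false true (phi i.+1 / (1 - phi i));
  lp_11 : forall i, (1 <= i)%N -> transition P X i i.+1 true true 0
}.

Definition independent_process d (T : measurableType d) (P : probability T R)
    (Y : nat -> {mfun T >-> bool}) : Prop :=
  forall (J : seq nat) (B : nat -> set bool),
    uniq J -> {in J, forall j, (1 <= j)%N} ->
    P (\bigcap_(j in [set` J]) (Y j @^-1` B j)) =
      (\prod_(j <- J) P (Y j @^-1` B j))%E.

Record feller_coupling (theta : nat -> R) d (T : measurableType d)
    (P : probability T R) (Y : nat -> {mfun T >-> bool}) : Prop := {
  fc_indep : independent_process P Y;
  fc_0 : forall i, (1 <= i)%N ->
    pr P (event Y i false) = (i.-1)%:R / ((i.-1)%:R + theta i)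
}.

End Processes.

(* Main.v *)
(* Erasing is a backward recursion: the image at [k] is [erase_step k y_k a],
   where [a] is the image at [k + 1], and the image under [chi n] vanishes at [n].
   With independent letters this makes the image, read in decreasing index, a
   Markov chain whose transitions are those of the derangement process.  For the
   second law, the images under [chi n] and [chiInf] agree up to [m] as soon as
   some letter in [m + 3, n) is 0, an event of probability
   1 - prod (1 - p_k) --> 1.  Hence phi_i = P(image of Y under chiInf is 1 at i),
   and the image under [chiInf] is a backward Markov chain with these marginals;
   reversing it gives the forward chain defining the limit process. *)
From HB Require Import structures.
Require Import Defs.
From mathcomp Require Import all_boot all_order all_algebra.
From mathcomp Require Import all_classical all_reals all_analysis.
From mathcomp Require Import ring lra.
Import Order.TTheory GRing.Theory Num.Theory.
Import numFieldNormedType.Exports.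

Set Implicit Arguments.
Unset Strict Implicit.
Unset Printing Implicit Defensive.

Local Open Scope classical_set_scope.
Local Open Scope ring_scope.

(** * Runs of ones and the backward recursion for erasing *)

Section Erasing.
Implicit Types (y : nat -> bool) (n i j m : nat).

Lemma all_ones0 y i : all_ones y i 0 = crd y i.
Proof.
apply/all_onesP/idP => [/(_ 0%N (leqnn _))|yi k]; first by rewrite addn0.
by rewrite leqn0 => /eqP ->; rewrite addn0.
Qed.

Lemma all_onesS y i j : all_ones y i j.+1 = crd y i && all_ones y i.+1 j.
Proof.
apply/all_onesP/andP => [H|[yi /all_onesP H] [|k] kj].
- split; first by have := H 0%N isT; rewrite addn0.
  by apply/all_onesP => k kj; rewrite addSnnS; exact: H.
- by rewrite addn0.
- by rewrite addnS -addSn; exact: H.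
Qed.

Lemma all_ones_le y i j m : (j <= m)%N -> all_ones y i m -> all_ones y i j.
Proof.
move=> jm /all_onesP H; apply/all_onesP => k kj.
by apply: H; exact: leq_trans jm.
Qed.

(** The length 0 is admissible as [y_i = 1], so the maximum is attained; a longer run inside the
    window would contradict maximality. *)
Lemma beta_spec n y i : (i < n)%N -> crd y i ->
  [/\ (beta n y i < n - i)%N, all_ones y i (beta n y i) &
      ((beta n y i).+1 < n - i)%N -> ~~ all_ones y i (beta n y i).+1].
Proof.
move=> i_n yi; have ni : (0 < n - i)%N by rewrite subn_gt0.
rewrite /beta yi mul1n.
have /(eq_bigmax_cond (fun j : 'I_(n - i) => j : nat))[j yj maxj] :
    (0 < #|[pred j : 'I_(n - i) | all_ones y i j]|)%N.
  by apply/card_gt0P; exists (Ordinal ni); rewrite inE /= all_ones0.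
rewrite [X in (X < _)%N]maxj [X in all_ones _ _ X]maxj; split => // {j yj maxj}.
set b := (\max_(_ < _ | _) _)%N => bn; apply/negP => yb.
suff : (b.+1 <= b)%N by rewrite ltnn.
by rewrite {2}/b; apply: (bigop.bigmax_sup (Ordinal bn)).
Qed.

(** Runs are closed under shortening, so of two distinct lengths with this property the smaller
    could be prolonged inside the window. *)
Lemma beta_unique n y i m : (m < n - i)%N -> all_ones y i m ->
  ((m.+1 < n - i)%N -> ~~ all_ones y i m.+1) -> beta n y i = m.
Proof.
move=> mn ym ySm.
have i_n : (i < n)%N by rewrite -subn_gt0; exact: leq_ltn_trans mn.
have yi : crd y i by rewrite -all_ones0; exact: all_ones_le ym.
have [bn yb ySb] := beta_spec i_n yi.
case: (ltngtP (beta n y i) m) => // lt.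
  by move: (ySb (leq_ltn_trans lt mn)); rewrite (all_ones_le lt).
by move: (ySm (leq_ltn_trans lt bn)); rewrite (all_ones_le lt).
Qed.

(* The update rule of the erased sequence: position [k] of the image is
   determined by [c = y_k] and by the value [a] of the image at [k + 1]. *)
Definition erase_step (k : nat) (c a : bool) : bool :=
  if k == 1%N then true else if k == 2%N then false else c && ~~ a.

(** Prepending a one lengthens the run that starts at [i.+1] by one and flips its parity. With no
    one at [i.+1] inside the window, the run at [i] has length 0, which is even. *)
Lemma Phi_erase_step n y i : (0 < i < n)%N ->
  Phi n y i = erase_step i (crd y i) (Phi n y i.+1).
Proof.
move=> /andP[i0 i_n]; rewrite /erase_step {1}/Phi.
case: eqP => // /eqP i1; case: eqP => // /eqP i2.
have i3 : (3 <= i)%N by move: i i0 i1 i2 {i_n} => [|[|[]]].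
rewrite /Phi i_n /= eqSS (gtn_eqF i0) eqSS (negPf i1).
case: (boolP (crd y i)) => //= yi.
case: (boolP ((i.+1 < n)%N && crd y i.+1)) => [/andP[Si_n ySi]|].
  have [bn yb ySb] := beta_spec Si_n ySi.
  rewrite Si_n ySi /= (@beta_unique n y i (beta n y i.+1).+1) ?negbK //.
  - by rewrite -(subnSK i_n) ltnS.
  - by rewrite all_onesS yi.
  - by rewrite -(subnSK i_n) ltnS all_onesS yi.
move=> /nandP[] nn; rewrite (@beta_unique n y i 0) ?all_ones0 ?subn_gt0 //.
- by rewrite (negPf nn).
- by rewrite -(subnSK i_n) ltnS subn_gt0 (negPf nn).
- by rewrite (negPf nn) andbF.
- by rewrite all_onesS all_ones0 (negPf nn) andbF.
Qed.

Lemma Phi_ge n y i : (1 < n <= i)%N -> Phi n y i = false.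
Proof.
move=> /andP[n1 ni]; rewrite /Phi gtn_eqF ?(leq_trans n1) // ltnNge ni.
by case: ifP.
Qed.

(* Once a 0 has been read, later letters no longer matter. *)
Lemma PhiInf_Phi (R : realType) n y i k : (i < k < n)%N -> ~~ crd y k ->
  PhiInf R y i = Phi n y i.
Proof.
move=> /andP[ik kn] yk; rewrite /PhiInf /Phi (ltn_trans ik kn) /=.
case: eqP => // _; case: eqP => // _.
case: (boolP (crd y i)) => //= yi.
have [bn yb ySb] := beta_spec (ltn_trans ik kn) yi.
have bE : betaInf R y i = (beta n y i)%:R%:E.
  apply/betaInfP; rewrite yi yb /=.
  (* In the second case a run of this length would cover position [k], where the letter is 0. *)
  case: (ltnP (beta n y i).+1 (n - i)) => [/ySb //|nb].
  apply: contra yk => /all_onesP/(_ (k - i)%N); rewrite subnKC ?(ltnW ik) //.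
  by apply; rewrite (leq_trans _ nb) // leq_sub2r // ltnW.
apply/asboolP/idP => [[m]|ob]; last by exists (beta n y i).
by rewrite bE => -[/eqP]; rewrite eqr_nat => /eqP ->.
Qed.

End Erasing.

(** * Real-valued probabilities, events and histories *)

Notation times r m := [set k | (r <= k <= m)%N].

Section Probability.
Context (R : realType) d (T : measurableType d) (P : probability T R).
Implicit Types (A B C : set T) (X : nat -> {mfun T >-> bool}).

Lemma prEFin A : measurable A -> P A = (pr P A)%:E.
Proof. by move=> mA; rewrite /pr fineK // fin_num_measure. Qed.

Lemma pr_ge0 A : 0 <= pr P A.
Proof. by rewrite /pr fine_ge0. Qed.

Lemma pr_set0 : pr P set0 = 0.
Proof. by rewrite /pr measure0. Qed.

Lemma pr_setT : pr P setT = 1.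
Proof. by rewrite /pr probability_setT. Qed.

Lemma pr_le A B : measurable A -> measurable B -> A `<=` B -> pr P A <= pr P B.
Proof.
by move=> mA mB AB; rewrite -lee_fin -!prEFin // le_measure // inE.
Qed.

Lemma pr_le1 A : measurable A -> pr P A <= 1.
Proof. by move=> mA; rewrite -pr_setT pr_le. Qed.

Lemma pr_setIC A B : measurable A -> measurable B ->
  pr P A = pr P (A `&` B) + pr P (A `&` ~` B).
Proof.
move=> mA mB; have mBC := measurableC mB.
apply: EFin_inj; rewrite EFinD -!prEFin //; try exact: measurableI.
rewrite -measureU ?setIUr ?setUv ?setIT //; try exact: measurableI.
- by rewrite -setIUr setUv setIT.
- by rewrite setIACA setICr setI0.
Qed.

Lemma pr_setC A : measurable A -> pr P (~` A) = 1 - pr P A.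
Proof.
by move=> mA; rewrite -pr_setT (@pr_setIC setT A) // !setTI addrAC subrr add0r.
Qed.

Lemma pr_setI1 A B : measurable A -> measurable B -> pr P B = 1 ->
  pr P (A `&` B) = pr P A.
Proof.
move=> mA mB PB; rewrite [RHS](pr_setIC mA mB).
have mBC := measurableC mB; have mABC := measurableI _ _ mA mBC.
have := pr_le mABC mBC (@subIsetr _ A (~` B)).
by rewrite pr_setC // PB subrr; have := pr_ge0 (A `&` ~` B); lra.
Qed.

Lemma pr_setI0 A B : measurable A -> measurable B -> pr P B = 0 ->
  pr P (A `&` B) = 0.
Proof.
move=> mA mB PB; apply/eqP; rewrite eq_le pr_ge0 andbT -PB.
by rewrite pr_le //; exact: measurableI.
Qed.

(** The coupling inequality: the parts of [A] and [B] outside [C] cancel, and the two remaining ones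
    lie between 0 and the probability of [C]. *)
Lemma pr_dist_le A B C : measurable A -> measurable B -> measurable C ->
  A `&` ~` C = B `&` ~` C -> `|pr P A - pr P B| <= pr P C.
Proof.
move=> mA mB mC AB; rewrite (pr_setIC mA mC) (pr_setIC mB mC) AB.
rewrite opprD addrACA subrr addr0.
have mAC := measurableI _ _ mA mC; have mBC := measurableI _ _ mB mC.
have AC := pr_le mAC mC (@subIsetr _ A C).
have BC := pr_le mBC mC (@subIsetr _ B C).
have A0 := pr_ge0 (A `&` C); have B0 := pr_ge0 (B `&` C).
by rewrite ler_norml; apply/andP; split; lra.
Qed.

Lemma measurable_event X k b : measurable (event X k b).
Proof.
by have := measurable_funPT (X k) measurableT [set b] Logic.I; rewrite setTI.
Qed.

Lemma measurable_history X I x : measurable (history X I x).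
Proof. by apply: bigcap_measurableType => k _; exact: measurable_event. Qed.

Lemma event_negb X k b : event X k (~~ b) = ~` event X k b.
Proof.
by apply/seteqP; split => w; rewrite /event /=; case: (X k w) b => -[].
Qed.

Lemma pr_event_negb X A k b : measurable A ->
  pr P (A `&` event X k (~~ b)) = pr P A - pr P (A `&` event X k b).
Proof.
move=> mA; rewrite event_negb (pr_setIC mA (measurable_event X k b)).
by rewrite addrC addKr.
Qed.

Lemma eq_history X I x z : {in I, x =1 z} -> history X I x = history X I z.
Proof. by move=> xz; apply: eq_bigcapr => k Ik; rewrite xz // inE. Qed.

Lemma history_setU1 X I x k :
  history X (k |` I) x = event X k (x k) `&` history X I x.
Proof. exact: bigcap_setU1. Qed.

Lemma history_sub X I k x : I k -> history X I x `<=` event X k (x k).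
Proof. by move=> Ik w; exact. Qed.

(** Multiplicative form of the Markov property. It also covers null histories, where the conditional
    statement is silent: there both sides vanish. *)
Lemma markov_step_transition X (I : set nat) s t (x : nat -> bool) b q :
  I s -> markov_step P X I s t -> transition P X s t (x s) b q ->
  pr P (event X t b `&` history X I x) = pr P (history X I x) * q.
Proof.
move=> Is XI Xst; have mh := measurable_history X I x.
have [h0|h0] := eqVneq (pr P (history X I x)) 0.
  by rewrite h0 mul0r pr_setI0 //; exact: measurable_event.
have s0 : pr P (event X s (x s)) != 0.
  rewrite gt_eqF // (lt_le_trans (y := pr P (history X I x))) //.
    by rewrite lt_neqAle eq_sym h0 pr_ge0.
  by apply: pr_le => //; [exact: measurable_event|exact: history_sub].
by have := XI x b h0; rewrite (Xst s0) /cpr => <-; rewrite mulrC divfK.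
Qed.

End Probability.

Lemma times_recl r m : (r <= m)%N -> times r m = r |` times r.+1 m.
Proof.
move=> rm; apply/seteqP; split => [k /= /andP[rk km]|k /= [->|/andP[rk ->]]].
- by move: rk; rewrite leq_eqVlt => /orP[/eqP ->|rk]; [left|right; rewrite rk].
- by rewrite leqnn.
- by rewrite ltnW.
Qed.

Lemma times_recr r m : (r <= m.+1)%N -> times r m.+1 = m.+1 |` times r m.
Proof.
move=> rm; apply/seteqP; split => [k /= /andP[rk km]|k /= [->|/andP[-> km]]].
- by move: km; rewrite leq_eqVlt => /orP[/eqP ->|km]; [left|right; rewrite rk].
- by rewrite rm leqnn.
- by rewrite leqW.
Qed.

Lemma times1 m : times m m = [set m].
Proof.
apply/seteqP; split => k /=; first by move/anti_leq.
by move=> ->; rewrite leqnn.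
Qed.

Section Coordinates.
Context d (T : measurableType d) (f : {mfun T >-> binseq}).

Definition coordinate (k : nat) (w : T) : bool := crd (f w) k.

Lemma measurable_coordinate k : measurable_fun setT (coordinate k).
Proof.
by apply: (measurableT_comp (measurable_crd k)); exact: measurable_funPT.
Qed.

HB.instance Definition _ k :=
  isMeasurableFun.Build _ _ T bool (coordinate k) (measurable_coordinate k).

(** A random sequence is read as a process again, with [f] as its trajectory, so that erased
    sequences have events and histories. *)
Definition coordinate_process (k : nat) : {mfun T >-> bool} := coordinate k.

End Coordinates.

(** * Uniqueness of a law given its cylinder probabilities *)

Section Uniqueness.
Context (R : realType).

(* Sets determined by finitely many coordinates form a pi-system, and each is a
   finite union of cylinders of any sufficiently large length. *)
Lemma eq_distribution_trajectory d (T : measurableType d) (P : probability T R)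
    d' (T' : measurableType d') (P' : probability T' R)
    (X : nat -> {mfun T >-> bool}) (X' : nat -> {mfun T' >-> bool}) (M : nat) :
    (forall m x, (M <= m)%N ->
      pr P (history X (times 1 m) x) = pr P' (history X' (times 1 m) x)) ->
  forall A : set binseq, measurable A ->
    distribution P (trajectory X) A = distribution P' (trajectory X') A.
Proof.
move=> XX' A mA.
pose G := [set A : set binseq | exists N : nat, forall y z : nat -> bool,
  (forall k, (k < N)%N -> y k = z k) -> A y = A z].
have GE B N : (forall y z : nat -> bool,
    (forall k, (k < N)%N -> y k = z k) -> B y = B z) ->
    measurable (B : set binseq).
  move=> BN; have -> : B = (fun y : binseq => `[< B y >]) @^-1` [set true].
    by apply/seteqP; split => y /asboolP.
  rewrite -[X in measurable X]setTI.
  apply: (@measurable_finite_dep (fun y => `[< B y >]) N) => // y z yz.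
  by rewrite (BN _ _ yz).
pose cyl m (z : nat -> bool) := [set y : binseq | forall k, (k < m)%N -> y k = z k].
have mcyl m z : measurable (cyl m z).
  apply: (GE _ m) => y y' yy'; apply/propext.
  by split => H k km; rewrite -H // yy'.
(* Position [k] of a sequence stores the coordinate [k.+1], hence the shift [k.-1]. *)
have cylE dd (U : measurableType dd) (Z : nat -> {mfun U >-> bool}) m z :
    trajectory Z @^-1` cyl m z = history Z (times 1 m) (fun k => z k.-1).
  apply/seteqP; split => w H k /=; last by move=> km; exact: (H k.+1).
  by case: k => // k km; exact: (H k).
pose mu := distribution P (trajectory X).
pose nu := distribution P' (trajectory X').
have cyl_eq m z : (M <= m)%N -> mu (cyl m z) = nu (cyl m z).
  move=> Mm; rewrite /mu /nu /distribution /pushforward !cylE.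
  by rewrite !prEFin ?XX' //; exact: measurable_history.
pose ext N (t : {ffun 'I_N -> bool}) (k : nat) : bool :=
  if insub k is Some i then t i else false.
apply: (@measure_unique _ R binseq G (fun=> setT)) mA; last 3 first.
- by rewrite bigcup_const.
- move=> B [N BN].
  (* Enlarging [N] to [N + M] makes the cylinders long enough for the hypothesis. *)
  have {}BN : forall y z : nat -> bool,
      (forall k, (k < N + M)%N -> y k = z k) -> B y = B z.
    by move=> y z yz; apply: BN => k kN; apply: yz; rewrite ltn_addr.
  have -> : B = \bigcup_(t in [set t : {ffun 'I_(N + M) -> bool} | B (ext _ t)])
      cyl (N + M)%N (ext _ t).
    apply/seteqP; split => [y By|y [t /= Bt yt]]; last by rewrite (BN _ _ yt).
    have yE k : (k < N + M)%N -> y k = ext _ [ffun i : 'I_(N + M) => y i] k.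
      by move=> kN; rewrite /ext insubT ffunE.
    by exists [ffun i : 'I_(N + M) => y i] => //=; rewrite -(BN _ _ yE).
  have tr : trivIset [set t : {ffun 'I_(N + M) -> bool} | B (ext _ t)]
      (fun t => cyl (N + M)%N (ext _ t)).
    move=> s t _ _ [y [ys yt]]; apply/ffunP => i.
    by have := ys i (ltn_ord i); rewrite (yt i (ltn_ord i)) /ext !valK.
  have fin : finite_set [set t : {ffun 'I_(N + M) -> bool} | B (ext _ t)].
    by [].
  rewrite !(measure_fin_bigcup _ fin tr) //.
  by apply: eq_fsbigr => t _; apply: cyl_eq; rewrite leq_addl.
- by move=> _; rewrite -ge0_fin_numE // fin_num_measure.
- rewrite eqEsubset; split => B.
    apply: sub_sigma_algebra2 => C [k _ [D mD <-]]; exists k.+1 => y z yz.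
    by rewrite setTI /preimage /= yz.
  apply: (smallest_sub (@sigma_algebra_measurable _ binseq)).
  by move=> {}B [N BN]; exact: GE BN.
- move=> B C [N BN] [K CK]; exists (N + K)%N => y z yz.
  rewrite /setI /= (BN y z) 1?(CK y z) // => k kN; apply: yz.
    by rewrite ltn_addl.
  by rewrite ltn_addr.
- by move=> _; exists 0%N.
Qed.

End Uniqueness.

(** * Vanishing of a product when the sum diverges *)

Section DivergentProduct.
Context (R : realType) (p : nat -> R) (a : nat).
Hypothesis a1 : (1 <= a)%N.
Hypothesis p01 : forall k, (1 <= k)%N -> 0 <= p k <= 1.

Lemma prod1B_ge0 n : 0 <= \prod_(a <= k < n) (1 - p k).
Proof.
rewrite big_nat_cond prodr_ge0 // => k /andP[/andP[ak _] _].
by rewrite subr_ge0; have /andP[] := p01 (leq_trans a1 ak).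
Qed.

(** By induction, since [(1 - q) * (1 + S + q) <= 1 + S] for [q, S >= 0]. A large sum thus forces a
    small product. *)
Lemma prod1B_sum_le n :
  (\prod_(a <= k < n) (1 - p k)) * (1 + \sum_(a <= k < n) p k) <= 1.
Proof.
elim: n => [|n IH]; first by rewrite !big_geq // addr0 mulr1.
have [an|na] := leqP a n; last by rewrite !big_geq // addr0 mulr1.
rewrite !big_nat_recr //=; apply: le_trans IH.
have := prod1B_ge0 n; have /andP[p0 p1] := p01 (leq_trans a1 an).
have : 0 <= \sum_(a <= k < n) p k.
  rewrite big_nat_cond sumr_ge0 // => k /andP[/andP[ak _] _].
  by have /andP[] := p01 (leq_trans a1 ak).
move: (\prod_(_ <= _ < _) _) (\sum_(_ <= _ < _) _) (p n) p0 p1 => Q S q q0 q1 S0 Q0.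
rewrite -mulrA ler_wpM2l //; nra.
Qed.

Lemma prod1B_cvg0 : (\sum_(1 <= j <oo) (p j)%:E = +oo)%E ->
  \prod_(a <= k < n) (1 - p k) @[n --> \oo] --> (0 : R).
Proof.
move=> poo.
have p0 n : (1 <= n)%N -> true -> (0 <= (p n)%:E)%E.
  by move=> n1 _; rewrite lee_fin; have /andP[] := p01 n1.
have /cvgeyPge sumoo :
    (\sum_(1 <= j < n) (p j)%:E)%E @[n --> \oo] --> (+oo%E : \bar R).
  by rewrite -poo; exact: is_cvg_nneseries p0.
apply/cvgrPdist_le => e e0; near=> n.
rewrite sub0r normrN ger0_norm ?prod1B_ge0 //.
have an : (a <= n)%N by near: n; exact: nbhs_infty_ge.
(* The threshold includes the head of the sum below [a], so that the part from [a] on is at least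
   [e^-1]. *)
have : (((e^-1 + \sum_(1 <= j < a) p j))%:E <= \sum_(1 <= j < n) (p j)%:E)%E.
  by near: n; exact: sumoo.
rewrite sumEFin lee_fin (@big_cat_nat _ _ _ a 1 n) //= [leRHS]addrC lerD2r => se.
have := prod1B_sum_le n; have := prod1B_ge0 n.
move: (\prod_(_ <= _ < _) _) (\sum_(a <= _ < _) _) se => Q S eS Q0 QS.
have e'0 : 0 < e^-1 by rewrite invr_gt0.
rewrite -(ler_pM2r e'0) divff ?gt_eqF //; apply: le_trans QS.
by rewrite ler_wpM2l //; lra.
Unshelve. all: by end_near.
Qed.

End DivergentProduct.

(** * Path probabilities of the erased Feller coupling *)

Section FellerSide.
Context (R : realType) d (T : measurableType d) (P : probability T R).
Context (Y : nat -> {mfun T >-> bool}) (indepY : independent_process P Y).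
Implicit Types (x : nat -> bool) (n m r k : nat).

Definition erased n : nat -> {mfun T >-> bool} :=
  coordinate_process (chi n \o trajectory Y : {mfun T >-> binseq}).

Definition erasedInf : nat -> {mfun T >-> bool} :=
  coordinate_process (chiInf R \o trajectory Y : {mfun T >-> binseq}).

(** The backward transition probability from [a] at [k.+1] to [b] at [k]; the letter [Y k] is the
    only randomness. *)
Definition erase_kernel k (a b : bool) : R :=
  pr P (Y k @^-1` [set c | erase_step k c a = b]).

Lemma erased_step n k w : (0 < k < n)%N ->
  erased n k w = erase_step k (Y k w) (erased n k.+1 w).
Proof. by case: k => // k kn; exact: Phi_erase_step. Qed.

Lemma erased_ge n k w : (1 < n <= k)%N -> erased n k w = false.
Proof.
case: k => [|k]; first by case/andP=> n1; rewrite leqn0=> /eqP n0; rewrite n0 in n1.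
by move=> nk; exact: Phi_ge.
Qed.

Lemma measurable_preimage_bool k (B : set bool) : measurable (Y k @^-1` B).
Proof. by rewrite -[X in measurable X]setTI; exact: measurable_funPT. Qed.

Lemma pr_independent (J : seq nat) (B : nat -> set bool) :
  uniq J -> {in J, forall j, (1 <= j)%N} ->
  pr P (\bigcap_(j in [set` J]) (Y j @^-1` B j)) =
  \prod_(j <- J) pr P (Y j @^-1` B j).
Proof.
move=> uJ J1; rewrite /pr indepY //.
rewrite (eq_bigr (fun j => (pr P (Y j @^-1` B j))%:E)) ?prodEFin //.
by move=> j _; rewrite prEFin //; exact: measurable_preimage_bool.
Qed.

(** As the image at [n] is 0, a prescribed path amounts to one condition on each letter separately,
    which is the form that independence needs. *)
Lemma history_erased n r x : (1 < n)%N -> (0 < r <= n)%N -> x n = false ->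
  history (erased n) (times r n) x =
  \bigcap_(k in [set` index_iota r n])
    (Y k @^-1` [set c | erase_step k c (x k.+1) = x k]).
Proof.
move=> n1 /andP[r0 rn] xn; apply/seteqP; split => w H k.
  rewrite /= mem_index_iota => /andP[rk kn].
  rewrite /preimage /= -(H k) /=; last by rewrite rk ltnW.
  rewrite -(H k.+1) /=; last by rewrite ltnW.
  by rewrite -erased_step // kn (leq_trans r0).
move=> /= /andP[rk kn].
(* The path is recovered downwards from [n], by induction on the distance [j] to [n]. *)
have [j jE] : exists j, (k + j = n)%N by exists (n - k)%N; exact: subnKC.
change (erased n k w = x k); elim: j k jE rk kn => [|j IH] k jE rk kn.
  by move: jE; rewrite addn0 => ->; rewrite xn erased_ge // n1 leqnn.
have {}kn : (k < n)%N by rewrite -jE addnS ltnS leq_addr.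
rewrite erased_step ?kn ?(leq_trans r0) // IH // ?addSnnS //; last exact: leqW.
by apply: (H k); rewrite /= mem_index_iota rk.
Qed.

Lemma pr_history_erased_full n r x : (1 < n)%N -> (0 < r <= n)%N ->
  pr P (history (erased n) (times r n) x) =
  (~~ x n)%:R * \prod_(r <= k < n) erase_kernel k (x k.+1) (x k).
Proof.
move=> n1 rn; case: (boolP (x n)) => xn.
  rewrite mul0r (_ : history _ _ _ = set0) ?pr_set0 //.
  apply/seteqP; split => // w H; have : erased n n w = x n.
    by apply: (H n); case/andP: rn => _ rn; rewrite /= rn leqnn.
  by rewrite xn erased_ge // n1 leqnn.
rewrite mul1r history_erased //; last exact: negPf.
rewrite pr_independent ?iota_uniq // => j; rewrite mem_index_iota => /andP[+ _].
by apply: leq_trans; case/andP: rn.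
Qed.

(** Positions above [m] are summed out one at a time, from [n] downwards; each summation only
    changes a coefficient that depends on [x m]. *)
Lemma pr_history_erased n m r x : (1 < n)%N -> (0 < r <= m)%N -> (m <= n)%N ->
  pr P (history (erased n) (times r m) x) =
  pr P (event (erased n) m (x m)) * \prod_(r <= k < m) erase_kernel k (x k.+1) (x k).
Proof.
move=> n1 rm mn.
(* Any coefficient depending on [x m] alone will do: the case [r = m] identifies it as the
   marginal. *)
suff [a aE] : exists a : bool -> R, forall r x, (0 < r <= m)%N ->
    pr P (history (erased n) (times r m) x) =
    a (x m) * \prod_(r <= k < m) erase_kernel k (x k.+1) (x k).
  rewrite aE //; congr (_ * _).
  have := aE m x; rewrite times1 big_geq // mulr1 /history bigcap_set1 => -> //.
  by rewrite leqnn andbT; case/andP: rm => /leq_trans; apply.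
have [j jE] : exists j, (m + j = n)%N by exists (n - m)%N; exact: subnKC.
elim: j m jE {r x rm mn} => [|j IH] m jE.
  rewrite addn0 in jE; rewrite jE; exists (fun b => (~~ b)%:R) => r x rm.
  exact: pr_history_erased_full.
have [|a aE] := IH m.+1; first by rewrite addSnnS.
exists (fun c => \sum_b a b * erase_kernel m b c) => r x /andP[r0 rm].
(* [upd b] prolongs the path by the value [b] at [m.+1], so that the case [m.+1] applies. *)
pose upd b k := if k == m.+1 then b else x k.
have E b : pr P (history (erased n) (times r m) x `&` event (erased n) m.+1 b) =
    a b * erase_kernel m b (x m) * \prod_(r <= k < m) erase_kernel k (x k.+1) (x k).
  rewrite setIC -{1}(_ : upd b m.+1 = b); last by rewrite /upd eqxx.
  rewrite (@eq_history _ _ _ _ _ (upd b)); last first.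
    by move=> k; rewrite inE /upd /= => /andP[_ km]; rewrite ltn_eqF.
  rewrite -history_setU1 -times_recr ?leqW // aE ?r0 ?leqW //.
  have -> : \prod_(r <= k < m.+1) erase_kernel k (upd b k.+1) (upd b k) =
      erase_kernel m b (x m) * \prod_(r <= k < m) erase_kernel k (x k.+1) (x k).
    rewrite big_nat_recr //= mulrC /upd eqxx ltn_eqF //; congr (_ * _).
    by apply: eq_big_nat => k /andP[_ km]; rewrite !ltn_eqF // ltnS ltnW.
  by rewrite mulrA /upd eqxx.
have mh := measurable_history (erased n) (times r m) x.
rewrite (pr_setIC P mh (measurable_event (erased n) m.+1 true)).
by rewrite -event_negb !E big_bool mulrDl.
Qed.

Section Limit.
Context (p : nat -> R).
Hypothesis p01 : forall k, (1 <= k)%N -> 0 <= p k <= 1.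
Hypothesis Yp : forall k, (3 <= k)%N -> pr P (event Y k false) = p k.
Hypothesis poo : (\sum_(1 <= j <oo) (p j)%:E = +oo)%E.

(* The two erasures agree up to [m] unless [Y] is constantly 1 on [m + 3, n). *)
Lemma cvg_pr_history_erased r m x : (0 < r)%N ->
  pr P (history (erased n) (times r m) x) @[n --> \oo] -->
  pr P (history erasedInf (times r m) x).
Proof.
move=> r0; apply/cvgrPdist_le => e e0.
have /cvgrPdist_le/(_ e e0) := prod1B_cvg0 (isT : (1 <= m.+3)%N) p01 poo.
apply: filterS => n; rewrite sub0r normrN ger0_norm ?prod1B_ge0 //.
apply: le_trans.
(* Starting at [m.+3] keeps every index above [m] and at least 3, where [Yp] gives the law of the
   letter. *)
pose C := \bigcap_(k in [set` index_iota m.+3 n]) (Y k @^-1` [set true]).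
have mC : measurable C.
  by apply: bigcap_measurableType => k _; exact: measurable_preimage_bool.
have -> : \prod_(m.+3 <= k < n) (1 - p k) = pr P C.
  rewrite pr_independent ?iota_uniq //; last first.
    by move=> k; rewrite mem_index_iota => /andP[+ _]; case: k.
  apply: eq_big_nat => k /andP[mk _].
  rewrite -Yp ?(leq_trans _ mk) // -pr_setC; last exact: measurable_event.
  by rewrite -event_negb.
apply: pr_dist_le => //; try exact: measurable_history.
suff agree w k : ~ C w -> (0 < k <= m)%N -> erasedInf k w = erased n k w.
  apply/seteqP; split => w [H nC]; split => // k /= /andP[rk km].
    by rewrite /event /mkset -agree ?km ?(leq_trans r0) //; apply: H; rewrite /= rk.
  by rewrite /event /mkset agree ?km ?(leq_trans r0) //; apply: H; rewrite /= rk.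
move=> /existsNP[j /not_implyP[]]; rewrite /= mem_index_iota => /andP[mj jn].
rewrite /preimage /= => /negP Yj; case: k => // k km.
apply: (@PhiInf_Phi _ _ _ _ j); last by case: j mj Yj {jn}.
by rewrite jn andbT (leq_ltn_trans km) // ltnW // ltnW.
Qed.

End Limit.
End FellerSide.

(** * The kernel in terms of [p], and path probabilities of the derangement process *)

Section AlmostSure.
Context (R : realType) d (T : measurableType d) (P : probability T R).

Lemma pr_event_almost (X : nat -> {mfun T >-> bool}) (A : set T) k b c :
  measurable A -> pr P (event X k c) = 1 ->
  pr P (event X k b `&` A) = (b == c)%:R * pr P A.
Proof.
move=> mA Xc; have mX := measurable_event X k; rewrite setIC.
have [->|bc] := eqVneq b c; first by rewrite mul1r pr_setI1.
have {bc}-> : b = ~~ c by case: b c bc {Xc} => -[].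
by rewrite pr_event_negb // pr_setI1 // subrr mul0r.
Qed.

End AlmostSure.

Section Kernel.
Context (R : realType) d (T : measurableType d) (P : probability T R).
Context (Y : nat -> {mfun T >-> bool}) (p : nat -> R).
Hypothesis p2 : p 2%N = 1.
Hypothesis Yp : forall k, (3 <= k)%N -> pr P (event Y k false) = p k.

Lemma erase_kernel_cst k a b c : (forall y, erase_step k y a = c) ->
  erase_kernel P Y k a b = (c == b)%:R.
Proof.
move=> stepc; rewrite /erase_kernel; have [<-|cb] := eqVneq c b.
  rewrite (_ : _ @^-1` _ = setT) ?pr_setT //.
  by apply/seteqP; split => // w _ /=.
rewrite (_ : _ @^-1` _ = set0) ?pr_set0 //.
by apply/seteqP; split => // w /=; rewrite stepc => /eqP; rewrite (negPf cb).
Qed.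

Lemma erase_kernel1 a b : erase_kernel P Y 1 a b = b%:R.
Proof. by rewrite (@erase_kernel_cst _ _ _ true) //; case: b. Qed.

(** At [k = 2] the forced value 0 agrees with [p 2 = 1]. For larger [k] an image 1 at [k.+1] forces
    0, and otherwise the letter [Y k] is copied. *)
Lemma erase_kernelE k a b : (2 <= k)%N -> erase_kernel P Y k a b =
  if a then (~~ b)%:R else if b then 1 - p k else p k.
Proof.
rewrite leq_eqVlt => /orP[/eqP <-|k3].
  rewrite (@erase_kernel_cst _ _ _ false) // p2 subrr.
  by case: a b => -[].
have stepE c : erase_step k c a = c && ~~ a.
  by rewrite /erase_step; case: k k3 => [|[|[]]].
case: a stepE => stepE.
  rewrite (@erase_kernel_cst _ _ _ false); first by case: b.
  by move=> c; rewrite stepE andbF.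
rewrite /erase_kernel (_ : _ @^-1` _ = event Y k b); last first.
  by apply/seteqP; split => w; rewrite /event /= stepE andbT.
have <- := Yp k3; case: b => //.
by rewrite -pr_setC -?event_negb //; exact: measurable_event.
Qed.

Section Derangement.
Context d' (T' : measurableType d') (P' : probability T' R).
Context (X : nat -> {mfun T' >-> bool}) (n : nat).
Hypothesis n2 : (2 <= n)%N.
Hypothesis XP : derangement_process p n P' X.

(** Downward induction on [r], one transition per factor; the indicator comes from the prescribed
    values at [n.+1] and [n]. *)
Lemma pr_history_derangement r x : (0 < r <= n)%N ->
  pr P' (history X (times r n.+1) x) =
  (x n.+1 && ~~ x n)%:R * \prod_(r <= k < n) erase_kernel P Y k (x k.+1) (x k).
Proof.
move=> /andP[r0 rn]; have [j jE] : exists j, (r + j = n)%N.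
  by exists (n - r)%N; exact: subnKC.
elim: j r jE r0 rn => [|j IH] r jE r0 rn.
  rewrite addn0 in jE; rewrite jE big_geq // mulr1.
  rewrite times_recr // times1 !history_setU1 /history bigcap_set1.
  rewrite (pr_event_almost _ (measurable_event X n _) (dp_start XP)).
  rewrite -[event X n _]setIT (pr_event_almost _ measurableT (dp_n XP)) pr_setT.
  by case: (x n.+1) (x n) => -[]; rewrite !(mul0r, mul1r).
have {}rn : (r < n)%N by rewrite -jE addnS ltnS leq_addr.
have mh := measurable_history X (times r.+1 n.+1) x.
rewrite times_recl ?leqW 1?ltnW // history_setU1.
suff -> : pr P' (event X r (x r) `&` history X (times r.+1 n.+1) x) =
    pr P' (history X (times r.+1 n.+1) x) * erase_kernel P Y r (x r.+1) (x r).
  by rewrite IH // ?addSnnS // [in RHS]big_ltn // mulrC mulrCA.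
(* Index 1 is outside the range of the transition rules, but its value is almost surely 1, as the
   kernel at 1 demands. *)
have [r1|r1] := eqVneq r 1%N.
  subst r; rewrite (pr_event_almost _ mh (dp_1 XP)) erase_kernel1 mulrC.
  by case: (x 1%N).
have r2 : (1 < r)%N by rewrite ltn_neqAle eq_sym r1.
have rn1 : (2 <= r <= n.-1)%N by rewrite r2 -ltnS prednK // (leq_trans _ rn).
have Xr : markov_step P' X (times r.+1 n.+1) r.+1 r.
  by apply: (dp_markov XP); rewrite r0 ltnW.
have Sr : times r.+1 n.+1 r.+1 by rewrite /= leqnn ltnS ltnW.
have H b q := @markov_step_transition _ _ _ _ X _ r.+1 r x b q Sr Xr.
rewrite erase_kernelE //; case xS : (x r.+1) H => H; last first.
  case: (x r); first exact: H (dp_01 XP rn1).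
  exact: H (dp_00 XP rn1).
(* Only the move from 1 to 0 is prescribed; the move from 1 to 1 follows by complement. *)
have H0 := H _ _ (dp_10 XP rn1); rewrite mulr1 in H0.
case: (x r); last by rewrite H0 mulr1.
by rewrite setIC -[true]/(~~ false) pr_event_negb // setIC H0 subrr mulr0.
Qed.

Lemma pr_history_truncate x :
  pr P' (history (truncate n X) (times 1 n) x) =
  (~~ x n)%:R * \prod_(1 <= k < n) erase_kernel P Y k (x k.+1) (x k).
Proof.
(* [x'] supplies the start value 1 at [n.+1], a time absent from the truncated history. *)
pose x' k := if k == n.+1 then true else x k.
have xx' k : (k <= n)%N -> x' k = x k by move=> kn; rewrite /x' ltn_eqF.
have := @pr_history_derangement 1 x' (ltnW n2).
rewrite (@eq_big_nat _ _ _ _ _ _ (fun k => erase_kernel P Y k (x k.+1) (x k))); last first.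
  by move=> k /andP[_ kn]; rewrite !xx' // ltnW.
rewrite {2}/x' eqxx xx' //= => <-.
case: n n2 @x' xx' XP => // m m1 x' xx' XPm.
rewrite !times_recr // !history_setU1 {1}/x' eqxx xx' //.
have mh := measurable_history X (times 1 m) x'.
rewrite (pr_event_almost _ _ (dp_start XPm)); last first.
  by apply: measurableI => //; exact: measurable_event.
rewrite eqxx mul1r (pr_event_almost _ mh (dp_n XPm)).
have <- : history (truncate m.+1 X) (times 1 m) x = history X (times 1 m) x'.
  apply: eq_bigcapr => k /= /andP[_ km].
  by rewrite xx' 1?ltnW // /event /truncate ltnS km.
(* At the cut-off the truncated process is 0 everywhere, whereas [X] is so only almost surely. *)
case: (x m.+1).
  rewrite mul0r (_ : _ `&` _ = set0) ?pr_set0 //.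
  by apply/seteqP; split => // w []; rewrite /event /truncate ltnn.
rewrite mul1r (_ : event _ _ _ = setT) ?setTI //.
by apply/seteqP; split => // w _; rewrite /event /truncate ltnn.
Qed.

End Derangement.
End Kernel.

(** From [n] on the history only tests [x], so longer cylinders reduce to length [n], cut with
    everything or nothing. *)
Lemma history_vanishing d (T : measurableType d) (X : nat -> {mfun T >-> bool})
    n m x : (0 < n <= m)%N -> (forall k w, (n <= k)%N -> X k w = false) ->
  history X (times 1 m) x = history X (times 1 n) x `&`
    [set _ | forall k, (n <= k <= m)%N -> x k = false].
Proof.
move=> /andP[n0 nm] X0; apply/seteqP; split => [w H|w [H x0] k /= /andP[k0 km]].
  split=> [k /= /andP[k0 kn]|k /andP[nk km]].
    by apply: H; rewrite /= k0 (leq_trans kn).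
  by rewrite -(H k) /= ?km ?(leq_trans n0) // X0.
have [kn|nk] := leqP k n; first by apply: H; rewrite /= k0.
by rewrite /event /= X0 1?ltnW // x0 // km ltnW.
Qed.

(** * The law of the derangement process *)

Section FiniteLaw.
Context (R : realType) d (T : measurableType d) (P : probability T R).
Context (Y : nat -> {mfun T >-> bool}) (p : nat -> R).
Hypothesis indepY : independent_process P Y.
Hypothesis p2 : p 2%N = 1.
Hypothesis Yp : forall k, (3 <= k)%N -> pr P (event Y k false) = p k.

Lemma distribution_derangement d' (T' : measurableType d')
    (P' : probability T' R) (X : nat -> {mfun T' >-> bool}) n :
    (2 <= n)%N -> derangement_process p n P' X ->
  forall A : set binseq, measurable A ->
    distribution P' (trajectory (truncate n X)) A =
    distribution P (trajectory (erased Y n)) A.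
Proof.
move=> n2 XP; apply: (@eq_distribution_trajectory _ _ _ _ _ _ _ _ _ n) => m x nm.
have n0m : (0 < n <= m)%N by rewrite nm ltnW.
rewrite !(@history_vanishing _ _ _ n m) //.
- have [x0|x0] := pselect (forall k, (n <= k <= m)%N -> x k = false).
    have all0 U : [set _ : U | forall k, (n <= k <= m)%N -> x k = false] = setT.
      by apply/seteqP; split => // w _ k; exact: x0.
    rewrite !all0 !setIT (pr_history_truncate p2 Yp n2 XP).
    by apply/esym/(pr_history_erased_full indepY) => //; exact: ltnW.
  have no0 U : [set _ : U | forall k, (n <= k <= m)%N -> x k = false] = set0.
    by apply/seteqP; split => // w /x0.
  by rewrite !no0 !setI0 !pr_set0.
- by move=> k w nk; apply: erased_ge; rewrite n2.
- by move=> k w nk; rewrite /truncate ltnNge nk.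
Qed.

(** * The law of the limit process *)

Section InfiniteLaw.
Hypothesis p01 : forall k, (1 <= k)%N -> 0 <= p k <= 1.
Hypothesis poo : (\sum_(1 <= j <oo) (p j)%:E = +oo)%E.

Lemma cvg_pr_event_erased m b : (0 < m)%N ->
  pr P (event (erased Y n) m b) @[n --> \oo] --> pr P (event (erasedInf R Y) m b).
Proof.
move=> m0; have := @cvg_pr_history_erased _ _ _ _ _ indepY _ p01 Yp poo m m (fun=> b) m0.
by rewrite times1 /history bigcap_set1; under eq_fun do rewrite bigcap_set1.
Qed.

(** The formula for [erased Y n] passes to the limit: its product does not involve [n], and the
    marginals at [m] converge. *)
Lemma pr_history_erasedInf r m x : (0 < r <= m)%N ->
  pr P (history (erasedInf R Y) (times r m) x) =
  pr P (event (erasedInf R Y) m (x m)) *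
  \prod_(r <= k < m) erase_kernel P Y k (x k.+1) (x k).
Proof.
move=> /andP[r0 rm].
have := @cvg_pr_history_erased _ _ _ _ _ indepY _ p01 Yp poo r m x r0.
move=> /(cvg_lim (@Rhausdorff R)) <-.
apply: (cvg_lim (@Rhausdorff R)).
pose c : R := \prod_(r <= k < m) erase_kernel P Y k (x k.+1) (x k).
have H : pr P (event (erased Y n) m (x m)) * c @[n --> \oo] -->
    pr P (event (erasedInf R Y) m (x m)) * c.
  apply: cvgM; last exact: cvg_cst.
  exact: cvg_pr_event_erased (leq_trans r0 rm).
apply: cvg_trans H; apply: near_eq_cvg; near=> n.
rewrite (pr_history_erased indepY) ?r0 //; first by near: n; exact: nbhs_infty_gt.
by near: n; exact: nbhs_infty_ge.
Unshelve. all: by end_near.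
Qed.

(** Induction on the length of the path. For [m > 1], extending a path that ends in 0 at [m] by a 1
    replaces the factor [1 - phi m] by [phi m.+1], which is the ratio prescribed for [X]. *)
Lemma distribution_limit d' (T' : measurableType d') (P' : probability T' R)
    (X : nat -> {mfun T' >-> bool}) (phi : nat -> R) :
    (forall i, (0 < i)%N -> phi i = pr P (event (erasedInf R Y) i true)) ->
    limit_process phi P' X ->
  forall A : set binseq, measurable A ->
    distribution P' (trajectory X) A =
    distribution P (trajectory (erasedInf R Y)) A.
Proof.
move=> phiE XP; pose Z := erasedInf R Y.
have Z1 : pr P (event Z 1 true) = 1.
  by rewrite (_ : event Z 1 true = setT) ?pr_setT //; apply/seteqP; split.
have Z2 : pr P (event Z 2 true) = 0.
  by rewrite (_ : event Z 2 true = set0) ?pr_set0 //; apply/seteqP; split.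
apply: (@eq_distribution_trajectory _ _ _ _ _ _ _ _ _ 1) => m x.
elim: m => // -[_ _|m IH _].
  rewrite times1 /history !bigcap_set1 -[event X _ _]setIT -[event Z _ _]setIT.
  rewrite (pr_event_almost _ measurableT (lp_start XP)).
  by rewrite (pr_event_almost _ measurableT Z1) !pr_setT.
move: m.+1 (ltn0Sn m) IH => {}m m0 /(_ m0) IH.
have mX := measurable_history X (times 1 m) x.
have mZ := measurable_history Z (times 1 m) x.
rewrite !times_recr // !history_setU1.
(* The value 0 at [m.+1] follows by complement. *)
suff E : pr P' (event X m.+1 true `&` history X (times 1 m) x) =
    pr P (event Z m.+1 true `&` history Z (times 1 m) x).
  case: (x m.+1) => //; rewrite -[false]/(~~ true).
  rewrite setIC [in RHS]setIC !pr_event_negb // IH.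
  by rewrite setIC E setIC.
have mm : times 1 m m by rewrite /= m0 leqnn.
have Xm := @markov_step_transition _ _ _ _ X _ m m.+1 x true _ mm (lp_markov XP m0).
pose x' k := if k == m.+1 then true else x k.
have xx' k : (k <= m)%N -> x' k = x k by move=> km; rewrite /x' ltn_eqF.
have ZE : pr P (event Z m.+1 true `&` history Z (times 1 m) x) =
    pr P (event Z m.+1 true) * erase_kernel P Y m true (x m) *
    \prod_(1 <= k < m) erase_kernel P Y k (x k.+1) (x k).
  rewrite (@eq_history _ _ _ _ _ x'); last first.
    by move=> k; rewrite inE /= => /andP[_ km]; rewrite xx'.
  rewrite -{1}(_ : x' m.+1 = true); last by rewrite /x' eqxx.
  rewrite -history_setU1 -times_recr // pr_history_erasedInf //.
  have -> : \prod_(1 <= k < m.+1) erase_kernel P Y k (x' k.+1) (x' k) =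
      erase_kernel P Y m true (x m) *
      \prod_(1 <= k < m) erase_kernel P Y k (x k.+1) (x k).
    rewrite big_nat_recr //= mulrC (xx' m) // {1}/x' eqxx; congr (_ * _).
    by apply: eq_big_nat => k /andP[_ km]; rewrite !xx' // ltnW.
  by rewrite mulrA /x' eqxx.
have m2 : m != 1%N -> (1 < m)%N by rewrite ltn_neqAle eq_sym => ->.
case xm : (x m) Xm => Xm.
  rewrite (Xm _ (lp_11 XP m0)) mulr0 ZE xm.
  (* For [m = 1] the kernel gives 1 instead of 0, and the vanishing comes from the marginal at 2. *)
  have [->|/m2 m_gt1] := eqVneq m 1%N; first by rewrite Z2 !mul0r.
  by rewrite (erase_kernelE p2 Yp) // mulr0 mul0r.
rewrite (Xm _ (lp_01 XP m0)) IH.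
have Zm : pr P (event Z m false) = 1 - phi m.
  rewrite phiE // -pr_setC -?event_negb //; exact: measurable_event.
(* If [phi m = 1], the quotient is 0 as the inverse of 0 is 0, and the history, which ends in 0, is
   null. *)
have [phi1|phi1] := eqVneq (1 - phi m) 0.
  rewrite phi1 invr0 !mulr0 pr_setI0 //; first exact: measurable_event.
  by rewrite pr_history_erasedInf ?m0 // xm Zm phi1 mul0r.
have m_gt1 : (1 < m)%N.
  by apply: m2; apply: contra_neq phi1 => ->; rewrite phiE // Z1 subrr.
rewrite ZE pr_history_erasedInf ?m0 // xm Zm (erase_kernelE p2 Yp) //= mulr1 (phiE _ (ltn0Sn m)).
by field.
Qed.

End InfiniteLaw.
End FiniteLaw.

Theorem mainTheorem12 (R : realType) (theta p : nat -> R)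
  (theta_gt0 : forall i, (1 <= i)%N -> 0 < theta i)
  (theta1 : theta 1%N = 1)
  (p1 : p 1%N = 0) (p2 : p 2%N = 1)
  (pE : forall i, (3 <= i)%N -> p i = (i.-1)%:R / ((i.-1)%:R + theta i))
  (dY : measure_display) (TY : measurableType dY) (PY : probability TY R)
  (Y : nat -> {RV PY >-> bool}) (hY : feller_coupling theta PY Y)
  (d : nat -> measure_display) (T : forall n, measurableType (d n))
  (P : forall n, probability (T n) R)
  (X : forall n, nat -> {RV P n >-> bool})
  (hX : forall n, (2 <= n)%N -> derangement_process p n (P n) (X n)) :
  (forall n, (2 <= n)%N ->
     forall A : set binseq, measurable A ->
       distribution (P n) (trajectory (truncate n (X n))) A =
       distribution (distribution PY (trajectory Y)) (chi n) A) /\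
  ((\sum_(1 <= j <oo) (p j)%:E = +oo)%E ->
     forall (dI : measure_display) (TI : measurableType dI)
       (PI : probability TI R) (XI : nat -> {RV PI >-> bool}),
       limit_process (limit_density P X) PI XI ->
     forall A : set binseq, measurable A ->
       distribution PI (trajectory XI) A =
       distribution (distribution PY (trajectory Y)) (chiInf R) A).
Proof.
have indepY := fc_indep hY.
have Yp k : (3 <= k)%N -> pr PY (event Y k false) = p k.
  by move=> k3; rewrite (fc_0 hY) ?pE // (leq_trans _ k3).
have p01 k : (1 <= k)%N -> 0 <= p k <= 1.
  case: k => [|[|[|k]]] // _; rewrite ?p1 ?p2 ?lexx ?ler01 //.
  by rewrite -Yp // pr_ge0 pr_le1 //; exact: measurable_event.
have finite_law n A : (2 <= n)%N -> measurable A ->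
    distribution (P n) (trajectory (truncate n (X n))) A =
    distribution PY (trajectory (erased Y n)) A.
  by move=> n2; exact: (distribution_derangement indepY p2 Yp n2 (hX n n2)).
(* The iterated push-forward unfolds to the law of the erased trajectory. *)
split=> [n n2 A mA|poo dI TI PI XI XIP A mA]; first exact: finite_law.
apply: (distribution_limit indepY p2 Yp p01 poo _ XIP) mA => i i0.
(* It remains to compute the limit density: by the finite law, the marginals at [i] of [X n] and
   [erased Y n] agree as soon as [i < n]. *)
apply: (cvg_lim (@Rhausdorff R)).
have := @cvg_pr_event_erased _ _ _ _ _ _ indepY Yp p01 poo i true i0.
apply: cvg_trans; apply: near_eq_cvg; near=> n.
have n2 : (2 <= n)%N by near: n; exact: nbhs_infty_ge.
have i_n : (i < n)%N by near: n; exact: nbhs_infty_gt.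
have mi : measurable [set y : binseq | crd y i = true].
  by rewrite -[X in measurable X]setTI; exact: (@measurable_crd i measurableT [set true] Logic.I).
have := finite_law n _ n2 mi; rewrite /distribution /pushforward /pr => E.
have X_traj d' (U : measurableType d') (V : nat -> {mfun U >-> bool}) :
    trajectory V @^-1` [set y : binseq | crd y i = true] = event V i true.
  by case: (i) i0.
rewrite !X_traj in E; rewrite -E; congr (fine (P n _)).
by rewrite /event /truncate i_n.
Unshelve. all: by end_near.
Qed.
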